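(* For every $m\geq4$, the inclusion $\overline{\mathit{Tight}}_m\subseteq\overline{\mathit{Oblique}}_m$ of subvarieties of $\mathbb{C}^m\otimes\mathbb{C}^m\otimes\mathbb{C}^m$ is strict, where $\overline{\mathit{Tight}}_m$ and $\overline{\mathit{Oblique}}_m$ denote the (Zariski, equivalently Euclidean) closures of the sets of concise tight tensors and of concise oblique tensors.
   Context: Let $A=B=C=\mathbb{C}^m$. A tensor $T \in A\otimes B\otimes C$ is concise if the three induced linear maps $A^*\to B\otimes C$, $B^*\to A\otimes C$, $C^*\to A\otimes B$ are injective. Write $[m]=\{1,\dots,m\}$. A subset $\mathcal{S}\subseteq[m]\times[m]\times[m]$ is concise if its three projections to $[m]$ are surjective. A concise subset $\mathcal{S}$ is tight if there exist injective functions $\tau_A,\tau_B,\tau_C:[m]\to\mathbb{Z}$ such that $\tau_A(i)+\tau_B(j)+\tau_C(k)=0$ for every $(i,j,k)\in\mathcal{S}$; it is oblique if there are total orders on the three copies of $[m]$ such that no two distinct elements of $\mathcal{S}$ are comparable in the induced product partial order. A tensor in $A\otimes B\otimes C$ is tight (resp. oblique) if there exists some choice of bases of $A,B,C$ in which its support (the set of index triples of nonzero coefficients) is a tight (resp. oblique) subset. *)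

(* Defs.v *)
From HB Require Import structures.
From mathcomp Require Import all_boot all_order all_algebra.
From mathcomp Require Import all_classical reals topology normedtype.
From mathcomp.real_closed Require Import complex.
(* Not imported: its notations clash with those of mathcomp-analysis. *)
From mathcomp Require mpoly.

Set Implicit Arguments.
Unset Strict Implicit.
Unset Printing Implicit Defensive.

Import Order.TTheory GRing.Theory Num.Theory numFieldNormedType.Exports.

Local Open Scope ring_scope.

(* K^m is 'rV[K]_m, and K^m (x) K^m (x) K^m is the space of arrays of
   coordinates with respect to the tensor products of the standard basis
   vectors. *)
Definition triple (m : nat) : finType := ('I_m * 'I_m * 'I_m)%type.

Definition tensor (K : fieldType) (m : nat) := {ffun triple m -> K}.

Section Subsets.
Variable m : nat.
Implicit Type S : {set triple m}.

Definition concise_set S : Prop :=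
  [/\ [set p.1.1 | p in S] = [set: 'I_m],
      [set p.1.2 | p in S] = [set: 'I_m]
    & [set p.2 | p in S] = [set: 'I_m]]%SET.

Definition tight_set S : Prop :=
  concise_set S /\
  exists tA tB tC : 'I_m -> int,
    [/\ injective tA, injective tB, injective tC
      & forall i j k, (i, j, k) \in S -> tA i + tB j + tC k = 0].

Definition total_order (r : rel 'I_m) : Prop :=
  [/\ reflexive r, antisymmetric r, transitive r & total r].

Definition prod_order (rA rB rC : rel 'I_m) : rel (triple m) :=
  fun p q => [&& rA p.1.1 q.1.1, rB p.1.2 q.1.2 & rC p.2 q.2].

Definition oblique_set S : Prop :=
  concise_set S /\
  exists rA rB rC : rel 'I_m,
    [/\ total_order rA, total_order rB, total_order rC
      & forall p q, p \in S -> q \in S -> p != q ->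
          ~~ prod_order rA rB rC p q /\ ~~ prod_order rA rB rC q p].

End Subsets.

Section Tensors.
Variables (K : fieldType) (m : nat).
Implicit Type T : tensor K m.

(* The induced maps A^* -> B (x) C, B^* -> A (x) C and C^* -> A (x) B; a linear
   form is given by its coordinates in the dual of the standard basis. *)
Definition flatA T (u : 'rV[K]_m) : 'M[K]_m :=
  \matrix_(j, k) \sum_i u 0 i * T (i, j, k).
Definition flatB T (u : 'rV[K]_m) : 'M[K]_m :=
  \matrix_(i, k) \sum_j u 0 j * T (i, j, k).
Definition flatC T (u : 'rV[K]_m) : 'M[K]_m :=
  \matrix_(i, j) \sum_k u 0 k * T (i, j, k).

Definition concise T : Prop :=
  [/\ injective (flatA T), injective (flatB T) & injective (flatC T)].

(* a (x) b (x) c *)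
Definition pure_tensor (a b c : 'rV[K]_m) : tensor K m :=
  [ffun p => a 0 p.1.1 * b 0 p.1.2 * c 0 p.2].

(* The tensor whose coefficients in the bases a, b, c are given by X. *)
Definition tensor_in (a b c : m.-tuple 'rV[K]_m) (X : tensor K m) : tensor K m :=
  [ffun q => \sum_(p : triple m)
     X p * pure_tensor (tnth a p.1.1) (tnth b p.1.2) (tnth c p.2) q].

Definition tensor_supp (X : tensor K m) : {set triple m} :=
  finset (fun p => X p != 0).

Definition has_support_in_bases (P : {set triple m} -> Prop) T : Prop :=
  exists (a b c : m.-tuple 'rV[K]_m) (X : tensor K m),
    [/\ basis_of fullv a, basis_of fullv b, basis_of fullv c,
        T = tensor_in a b c X & P (tensor_supp X)].

Definition tight T : Prop := has_support_in_bases (@tight_set m) T.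
Definition oblique T : Prop := has_support_in_bases (@oblique_set m) T.

Definition Tight : set (tensor K m) := [set T | concise T /\ tight T]%classic.
Definition Oblique : set (tensor K m) :=
  [set T | concise T /\ oblique T]%classic.

Definition tensor_vec T : 'rV[K]_#|triple m| := \row_i T (enum_val i).

Definition zariski_closure (X : set (tensor K m)) : set (tensor K m) :=
  [set T | forall f : mpoly.mpoly #|triple m| K,
     (forall S, X S -> mpoly.meval (tensor_vec S 0) f = 0) ->
     mpoly.meval (tensor_vec T 0) f = 0]%classic.

End Tensors.

(* The topology of C is carried by the alias R[i]^o of R[i]. *)
Definition euclidean_closure (R : realType) (m : nat)
    (X : set (tensor (complex R) m)) : set (tensor (complex R) m) :=
  (@tensor_vec (complex R) m @^-1`
     closure (@tensor_vec (complex R) m @` X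
              : set 'rV[(complex R)^o]_#|triple m|))%classic.

(* Main.v *)
(* A tensor with tight support in some bases is annihilated by the triple of
   diagonal matrices with entries tA, tB, tC, which is not a triple of scalars.
   So on Tight a linear system whose coefficients are linear in the tensor has
   a non-zero solution, i.e. suitable maximal minors vanish there, and it is
   enough to find a concise oblique tensor annihilated by scalars only.

   Such a tensor, with coefficients 0 and 1, is built by adding one vector to
   each factor at a time.  For m = 4 its support is the antichain [seed], found
   by computer search among the antichains of [4]^3.  The step to m + 1 adds
   the triples (m, m, 0), (m, 0, m) and (m - 1, m, m): they involve two new
   indices each, so that the old equations of the system are undisturbed, and
   the new ones determine the new entries.  Such a tensor is
   automatically concise. *)
From HB Require Import structures.
Require Import Defs.
From mathcomp Require Import all_boot all_order all_algebra.
From mathcomp Require Import zify ring.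
From mathcomp Require Import all_classical reals topology normedtype.
From mathcomp.real_closed Require Import complex.
From mathcomp Require Import -(notations) mpoly.
Set Implicit Arguments.
Unset Strict Implicit.
Unset Printing Implicit Defensive.
Import Order.TTheory GRing.Theory Num.Theory.
Local Open Scope ring_scope.

(** * An antichain and its infinitesimal symmetries *)

Definition seed : seq (nat * nat * nat) :=
  [:: (0, 2, 3); (0, 3, 2); (1, 1, 3); (1, 2, 2); (1, 3, 1);
      (2, 0, 2); (2, 2, 1); (2, 3, 0); (3, 0, 1); (3, 1, 0)]%N.

(** One predicate on natural numbers serves all dimensions: the support in dimension [m] is its
    restriction to indices below [m], so dimension [m + 1] only adds triples. *)
Definition obl (i j k : nat) : bool :=
  [|| (i, j, k) \in seed,
      [&& 4 <= i, i == j & k == 0],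
      [&& 4 <= i, i == k & j == 0]
    | [&& 4 <= j, j == k & j == i.+1]]%N.

Lemma seed_lt i j k : (i, j, k) \in seed -> [/\ i < 4, j < 4 & k < 4]%N.
Proof. by rewrite !inE => /orP[|]; do ?case/orP; move=> /eqP[-> -> ->]. Qed.

Lemma obl_new i j k : (4 <= maxn i (maxn j k))%N ->
  obl i j k = [|| [&& 4 <= i, i == j & k == 0],
                  [&& 4 <= i, i == k & j == 0]
                | [&& 4 <= j, j == k & j == i.+1]]%N.
Proof.
rewrite /obl; case: (boolP (_ \in _)) => // /seed_lt[] i4 j4 k4.
by rewrite !leq_max leqNgt i4 leqNgt j4 leqNgt k4.
Qed.

(* The position of the [j]th vector in the orders on the second and third
   factors: those of index at least 4 are inserted, in decreasing order, between
   the vectors 0 and 1.  On the first factor the order is the natural one. *)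
Definition obl_pos (m j : nat) : nat :=
  if j == 0%N then 0%N else if (4 <= j)%N then (m.+1 - j)%N else (m + j)%N.

Lemma obl_pos_inj m : {in [pred j | (j < m)%N] &, injective (obl_pos m)}.
Proof. by move=> j k; rewrite !inE /obl_pos; do !case: ifP; lia. Qed.

Lemma seed_antichain :
  all (fun p => all (fun q => [&& p.1.1 <= q.1.1, p.1.2 <= q.1.2 & p.2 <= q.2]
                              ==> (p == q))%N seed) seed.
Proof. by vm_compute. Qed.

(** The cases follow whether each triple has an index at least 4. If one of them does, comparing
    explicit positions decides; otherwise both lie in [seed], which is an antichain for the natural
    orders. *)
Lemma obl_antichain m i j k i' j' k' :
  (j < m -> k < m -> j' < m -> k' < m ->
  obl i j k -> obl i' j' k' ->
  i <= i' -> obl_pos m j <= obl_pos m j' -> obl_pos m k <= obl_pos m k' ->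
  i = i' /\ j = j' /\ k = k')%N.
Proof.
move=> jm km jm' km' + + le_i le_j le_k.
have [i4|i4] := leqP 4 (maxn i (maxn j k));
  have [i4'|i4'] := leqP 4 (maxn i' (maxn j' k')).
- rewrite !obl_new // => 
    /or3P[]/and3P[? /eqP ? /eqP ?] /or3P[]/and3P[? /eqP ? /eqP ?];
  by subst; move: le_i le_j le_k; rewrite /obl_pos; do ?case: ifP => /=; lia.
- rewrite obl_new // /obl !inE => + /orP[|]; last by lia.
  move=> /or3P[]/and3P[? /eqP ? /eqP ?]; do ?case/orP; move=> /eqP[? ? ?];
  by subst; move: le_i le_j le_k; rewrite /obl_pos; do ?case: ifP => /=; lia.
- rewrite (@obl_new i') // /obl !inE => /orP[|]; last by lia.
  do ?case/orP; move=> /eqP[? ? ?] /or3P[]/and3P[? /eqP ? /eqP ?];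
  by subst; move: le_i le_j le_k; rewrite /obl_pos; do ?case: ifP => /=; lia.
- rewrite /obl => /orP[Sp|]; last by lia.
  case/orP=> [Sq|]; last by lia.
  have [_ j4 k4] := seed_lt Sp; have [_ j4' k4'] := seed_lt Sq.
  (* On indices below 4 the positions are in the natural order, so the comparison descends to
     [seed]. *)
  have pos_old a b :
      (a < 4 -> b < 4 -> b < m -> obl_pos m a <= obl_pos m b -> a <= b)%N.
    by rewrite /obl_pos; do !case: ifP => /=; lia.
  have /implyP Spq := allP (allP seed_antichain _ Sp) _ Sq.
  have /Spq/eqP[-> -> ->] // : [&& i <= i', j <= j' & k <= k']%N.
  by apply/and3P; split=> //; apply: pos_old.
Qed.

(** Triples agreeing in two coordinates are comparable, so an antichain contains at most one of
    them. This later isolates a single term in a sum. The bound [m] is just chosen above the indices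
    that [obl_pos] compares. *)
Lemma obl_freeA i i' j k : obl i j k -> obl i' j k -> i = i'.
Proof.
move=> Sp Sq; pose m := (maxn j k).+1.
have [jm km] : (j < m)%N /\ (k < m)%N by rewrite /m; lia.
by case/orP: (leq_total i i') => le_i;
  [have := obl_antichain jm km jm km Sp Sq le_i
  |have := obl_antichain jm km jm km Sq Sp le_i]; case.
Qed.

Lemma obl_freeB i j j' k : obl i j k -> obl i j' k -> j = j'.
Proof.
move=> Sp Sq; pose m := (maxn j (maxn j' k)).+1.
have [jm jm' km] : [/\ j < m, j' < m & k < m]%N by split; rewrite /m; lia.
by case/orP: (leq_total (obl_pos m j) (obl_pos m j')) => le_j;
  [have := obl_antichain jm km jm' km Sp Sq (leqnn _) le_j
  |have := obl_antichain jm' km jm km Sq Sp (leqnn _) le_j]; case=> // _ [].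
Qed.

Lemma obl_freeC i j k k' : obl i j k -> obl i j k' -> k = k'.
Proof.
move=> Sp Sq; pose m := (maxn j (maxn k' k)).+1.
have [jm km km'] : [/\ j < m, k < m & k' < m]%N by split; rewrite /m; lia.
by case/orP: (leq_total (obl_pos m k) (obl_pos m k')) => le_k;
  [have := obl_antichain jm km jm km' Sp Sq (leqnn _) (leqnn _) le_k
  |have := obl_antichain jm km' jm km Sq Sp (leqnn _) (leqnn _) le_k];
  case=> // _ [].
Qed.

(** * The annihilator of the 0-1 tensor supported on the antichain *)

Section Annihilator.
Variable K : fieldType.
Hypothesis two_neq0 : 2%:R != 0 :> K.
Implicit Types X Y Z : nat -> nat -> K.

(** The coefficient at [(i, j, k)] of the infinitesimal action of a triple of matrices on the 0-1
    tensor with support [obl]. Matrices are functions on [nat], so that the same ones serve in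
    dimensions [n] and [n + 1]. *)
Definition oact m X Y Z i j k : K :=
  \sum_(a <- iota 0 m) X i a * (obl a j k)%:R
  + \sum_(a <- iota 0 m) Y j a * (obl i a k)%:R
  + \sum_(a <- iota 0 m) Z k a * (obl i j a)%:R.

Definition scalar_upto m X (x : K) :=
  forall a b, (a < m)%N -> (b < m)%N -> X a b = x *+ (a == b).

Definition obl_rigid m := forall X Y Z,
  (forall i j k, (i < m)%N -> (j < m)%N -> (k < m)%N ->
    oact m X Y Z i j k = 0) ->
  exists x y z, [/\ x + y + z = 0,
    scalar_upto m X x, scalar_upto m Y y & scalar_upto m Z z].

(** These are the equations on the diagonal entries at the ten points of [seed]. They have rank 10
    in 12 unknowns, leaving just the two-parameter family of scalar triples. Each claim is certified
    by an explicit integer combination of the equations, so nothing is divided. *)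
Lemma seed_weights (x0 x1 x2 x3 y0 y1 y2 y3 z0 z1 z2 z3 : K) :
  x0 + y2 + z3 = 0 ->
  x0 + y3 + z2 = 0 ->
  x1 + y1 + z3 = 0 ->
  x1 + y2 + z2 = 0 ->
  x1 + y3 + z1 = 0 ->
  x2 + y0 + z2 = 0 ->
  x2 + y2 + z1 = 0 ->
  x2 + y3 + z0 = 0 ->
  x3 + y0 + z1 = 0 ->
  x3 + y1 + z0 = 0 ->
  [/\ x0 + y0 + z0 = 0, [/\ x1 = x0, x2 = x0 & x3 = x0],
      [/\ y1 = y0, y2 = y0 & y3 = y0] & [/\ z1 = z0, z2 = z0 & z3 = z0]].
Proof.
move=> e0 e1 e2 e3 e4 e5 e6 e7 e8 e9.
split.
- suff -> : x0 + y0 + z0 =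
      4%:R * (x0 + y2 + z3) - 3%:R * (x0 + y3 + z2)
      - 4%:R * (x1 + y1 + z3) - 2%:R * (x1 + y2 + z2)
      + 6%:R * (x1 + y3 + z1) + 5%:R * (x2 + y0 + z2)
      - 2%:R * (x2 + y2 + z1) - 3%:R * (x2 + y3 + z0)
      - 4%:R * (x3 + y0 + z1) + 4%:R * (x3 + y1 + z0)
      by rewrite e0 e1 e2 e3 e4 e5 e6 e7 e8 e9; ring.
  by ring.
- split; apply: subr0_eq.
  + suff -> : x1 - x0 =
      - (x0 + y2 + z3) + (x1 + y1 + z3) + (x1 + y2 + z2) - (x1 + y3 + z1)
      - (x2 + y0 + z2) + (x2 + y3 + z0) + (x3 + y0 + z1) - (x3 + y1 + z0)
      by rewrite e0 e2 e3 e4 e5 e7 e8 e9; ring.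
    by ring.
  + suff -> : x2 - x0 =
      - 2%:R * (x0 + y2 + z3) + (x0 + y3 + z2) + 2%:R * (x1 + y1 + z3)
      + (x1 + y2 + z2) - 3%:R * (x1 + y3 + z1) - 2%:R * (x2 + y0 + z2)
      + (x2 + y2 + z1) + 2%:R * (x2 + y3 + z0) + 2%:R * (x3 + y0 + z1)
      - 2%:R * (x3 + y1 + z0)
      by rewrite e0 e1 e2 e3 e4 e5 e6 e7 e8 e9; ring.
    by ring.
  + suff -> : x3 - x0 =
      - 3%:R * (x0 + y2 + z3) + 2%:R * (x0 + y3 + z2)
      + 3%:R * (x1 + y1 + z3) + 2%:R * (x1 + y2 + z2)
      - 5%:R * (x1 + y3 + z1) - 4%:R * (x2 + y0 + z2) + (x2 + y2 + z1)
      + 3%:R * (x2 + y3 + z0) + 4%:R * (x3 + y0 + z1)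
      - 3%:R * (x3 + y1 + z0)
      by rewrite e0 e1 e2 e3 e4 e5 e6 e7 e8 e9; ring.
    by ring.
- split; apply: subr0_eq.
  + suff -> : y1 - y0 =
      - (x0 + y2 + z3) + (x0 + y3 + z2) + (x1 + y1 + z3) - (x1 + y3 + z1)
      - (x2 + y0 + z2) + (x2 + y2 + z1)
      by rewrite e0 e1 e2 e4 e5 e6; ring.
    by ring.
  + suff -> : y2 - y0 =
      - (x0 + y2 + z3) + (x0 + y3 + z2) + (x1 + y1 + z3) + (x1 + y2 + z2)
      - 2%:R * (x1 + y3 + z1) - 2%:R * (x2 + y0 + z2) + (x2 + y2 + z1)
      + (x2 + y3 + z0) + (x3 + y0 + z1) - (x3 + y1 + z0)
      by rewrite e0 e1 e2 e3 e4 e5 e6 e7 e8 e9; ring.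
    by ring.
  + suff -> : y3 - y0 =
      - 2%:R * (x0 + y2 + z3) + 2%:R * (x0 + y3 + z2)
      + 2%:R * (x1 + y1 + z3) + (x1 + y2 + z2) - 3%:R * (x1 + y3 + z1)
      - 3%:R * (x2 + y0 + z2) + (x2 + y2 + z1) + 2%:R * (x2 + y3 + z0)
      + 2%:R * (x3 + y0 + z1) - 2%:R * (x3 + y1 + z0)
      by rewrite e0 e1 e2 e3 e4 e5 e6 e7 e8 e9; ring.
    by ring.
- split; apply: subr0_eq.
  + suff -> : z1 - z0 =
      - (x0 + y2 + z3) + (x0 + y3 + z2) + (x1 + y1 + z3) - (x1 + y3 + z1)
      - (x2 + y0 + z2) + (x2 + y2 + z1) + (x3 + y0 + z1) - (x3 + y1 + z0)
      by rewrite e0 e1 e2 e4 e5 e6 e8 e9; ring.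
    by ring.
  + suff -> : z2 - z0 =
      - 2%:R * (x0 + y2 + z3) + 2%:R * (x0 + y3 + z2)
      + 2%:R * (x1 + y1 + z3) + (x1 + y2 + z2) - 3%:R * (x1 + y3 + z1)
      - 2%:R * (x2 + y0 + z2) + (x2 + y2 + z1) + (x2 + y3 + z0)
      + 2%:R * (x3 + y0 + z1) - 2%:R * (x3 + y1 + z0)
      by rewrite e0 e1 e2 e3 e4 e5 e6 e7 e8 e9; ring.
    by ring.
  + suff -> : z3 - z0 =
      - 2%:R * (x0 + y2 + z3) + 2%:R * (x0 + y3 + z2)
      + 3%:R * (x1 + y1 + z3) + (x1 + y2 + z2) - 4%:R * (x1 + y3 + z1)
      - 3%:R * (x2 + y0 + z2) + (x2 + y2 + z1) + 2%:R * (x2 + y3 + z0)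
      + 3%:R * (x3 + y0 + z1) - 3%:R * (x3 + y1 + z0)
      by rewrite e0 e1 e2 e3 e4 e5 e6 e7 e8 e9; ring.
    by ring.
Qed.

(** Equations at 36 points outside [seed] kill the 36 off-diagonal entries one after the other; the
    equations at the points of [seed] then settle the diagonal ones. *)
Lemma obl_rigid4 : obl_rigid 4.
Proof.
move=> X Y Z E.
(* In this form simplification evaluates [obl] and keeps only the terms that occur. *)
have sumE (F : nat -> K) (b : pred nat) :
    foldr (fun a s => if b a then F a + s else s) 0 (iota 0 4) =
    \sum_(a <- iota 0 4) F a * (b a)%:R.
  elim: (iota 0 4) => [|a s IHs] /=; first by rewrite big_nil.
  by rewrite big_cons -IHs; case: (b a); rewrite ?mulr1 ?mulr0 ?add0r.
have {}E i j k : (i < 4)%N -> (j < 4)%N -> (k < 4)%N ->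
    foldr (fun a s => if obl a j k then X i a + s else s) 0 (iota 0 4)
    + foldr (fun a s => if obl i a k then Y j a + s else s) 0 (iota 0 4)
    + foldr (fun a s => if obl i j a then Z k a + s else s) 0 (iota 0 4) = 0.
  move=> i4 j4 k4; rewrite (sumE (X i) (fun a => obl a j k)).
  rewrite (sumE (Y j) (fun a => obl i a k)) (sumE (Z k) (obl i j)).
  exact: E.
(* Each of these equations has a single term not yet known to vanish. *)
have x03 : X 0%N 3%N = 0
  by have := (E 0 0 1)%N isT isT isT; rewrite /= ?addr0 ?add0r.
have y02 : Y 0%N 2%N = 0
  by have := (E 0 0 3)%N isT isT isT; rewrite /= ?addr0 ?add0r.
have y13 : Y 1%N 3%N = 0
  by have := (E 0 1 2)%N isT isT isT; rewrite /= ?addr0 ?add0r.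
have z03 : Z 0%N 3%N = 0
  by have := (E 0 2 0)%N isT isT isT; rewrite /= ?addr0 ?add0r.
have y01 : Y 0%N 1%N = 0
  by have := (E 1 0 3)%N isT isT isT; rewrite /= ?addr0 ?add0r.
have z02 : Z 0%N 2%N = 0
  by have := (E 1 2 0)%N isT isT isT; rewrite /= ?addr0 ?add0r.
have z32 : Z 3%N 2%N = 0
  by have := (E 2 0 3)%N isT isT isT; rewrite /= ?addr0 ?add0r.
have y12 : Y 1%N 2%N = 0
  by have := (E 2 1 1)%N isT isT isT; rewrite /= ?addr0 ?add0r.
have y10 : Y 1%N 0%N = 0
  by have := (E 2 1 2)%N isT isT isT; rewrite /= ?addr0 ?add0r.
have x21 : X 2%N 1%N = 0
  by have := (E 2 1 3)%N isT isT isT; rewrite /= ?addr0 ?add0r.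
have z30 : Z 3%N 0%N = 0
  by have := (E 2 3 3)%N isT isT isT; rewrite /= ?addr0 ?add0r.
have z31 : Z 3%N 1%N = 0
  by have := (E 3 0 3)%N isT isT isT; rewrite /= ?addr0 ?add0r.
have z20 : Z 2%N 0%N = 0
  by have := (E 3 1 2)%N isT isT isT; rewrite /= ?addr0 ?add0r.
have y21 : Y 2%N 1%N = 0
  by have := (E 3 2 0)%N isT isT isT; rewrite /= ?addr0 ?add0r.
have x31 : X 3%N 1%N = 0
  by have := (E 3 2 2)%N isT isT isT; rewrite /= ?addr0 ?add0r.
have x30 : X 3%N 0%N = 0
  by have := (E 3 2 3)%N isT isT isT; rewrite /= ?addr0 ?add0r.
have x01 : X 0%N 1%N = 0
  by have := (E 0 1 3)%N isT isT isT; rewrite /= y12 ?addr0 ?add0r.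
have x02 : X 0%N 2%N = 0
  by have := (E 0 3 0)%N isT isT isT; rewrite /= z02 ?addr0 ?add0r.
have y32 : Y 3%N 2%N = 0
  by have := (E 0 3 3)%N isT isT isT; rewrite /= z32 ?addr0 ?add0r.
have x12 : X 1%N 2%N = 0
  by have := (E 1 0 2)%N isT isT isT; rewrite /= y02 ?addr0 ?add0r.
have x13 : X 1%N 3%N = 0
  by have := (E 1 1 0)%N isT isT isT; rewrite /= z03 ?addr0 ?add0r.
have z13 : Z 1%N 3%N = 0
  by have := (E 1 1 1)%N isT isT isT; rewrite /= y13 ?addr0 ?add0r.
have z23 : Z 2%N 3%N = 0
  by have := (E 1 1 2)%N isT isT isT; rewrite /= y12 ?addr0 ?add0r.
have x10 : X 1%N 0%N = 0
  by have := (E 1 2 3)%N isT isT isT; rewrite /= y21 z32 ?addr0 ?add0r.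
have y31 : Y 3%N 1%N = 0
  by have := (E 1 3 3)%N isT isT isT; rewrite /= z31 ?addr0 ?add0r.
have y03 : Y 0%N 3%N = 0
  by have := (E 2 0 0)%N isT isT isT; rewrite /= z02 ?addr0 ?add0r.
have x23 : X 2%N 3%N = 0
  by have := (E 2 1 0)%N isT isT isT; rewrite /= y13 ?addr0 ?add0r.
have x20 : X 2%N 0%N = 0
  by have := (E 2 2 3)%N isT isT isT; rewrite /= z31 ?addr0 ?add0r.
have z01 : Z 0%N 1%N = 0
  by have := (E 3 0 0)%N isT isT isT; rewrite /= y01 ?addr0 ?add0r.
have z10 : Z 1%N 0%N = 0
  by have := (E 3 1 1)%N isT isT isT; rewrite /= y10 ?addr0 ?add0r.
have y30 : Y 3%N 0%N = 0
  by have := (E 3 3 1)%N isT isT isT; rewrite /= x31 ?addr0 ?add0r.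
have y23 : Y 2%N 3%N = 0
  by have := (E 0 2 2)%N isT isT isT; rewrite /= x01 z23 ?addr0 ?add0r.
have z12 : Z 1%N 2%N = 0
  by have := (E 0 3 1)%N isT isT isT; rewrite /= x01 ?addr0 ?add0r.
have z21 : Z 2%N 1%N = 0
  by have := (E 1 3 2)%N isT isT isT; rewrite /= x10 y32 ?addr0 ?add0r.
have x32 : X 3%N 2%N = 0
  by have := (E 3 3 0)%N isT isT isT; rewrite /= y31 ?addr0 ?add0r.
have y20 : Y 2%N 0%N = 0
  by have := (E 2 2 2)%N isT isT isT; rewrite /= x21 z21 ?addr0 ?add0r.
(* At a point of the antichain each sum reduces to its diagonal term, since no other point of the
   antichain agrees with it in two coordinates. *)
have := (E 0 2 3)%N isT isT isT; rewrite /= !addr0 => e0.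
have := (E 0 3 2)%N isT isT isT; rewrite /= !addr0 => e1.
have := (E 1 1 3)%N isT isT isT; rewrite /= !addr0 => e2.
have := (E 1 2 2)%N isT isT isT; rewrite /= !addr0 => e3.
have := (E 1 3 1)%N isT isT isT; rewrite /= !addr0 => e4.
have := (E 2 0 2)%N isT isT isT; rewrite /= !addr0 => e5.
have := (E 2 2 1)%N isT isT isT; rewrite /= !addr0 => e6.
have := (E 2 3 0)%N isT isT isT; rewrite /= !addr0 => e7.
have := (E 3 0 1)%N isT isT isT; rewrite /= !addr0 => e8.
have := (E 3 1 0)%N isT isT isT; rewrite /= !addr0 => e9.
have [s0 [x1 x2 x3] [y1 y2 y3] [z1 z2 z3]] :=
  seed_weights e0 e1 e2 e3 e4 e5 e6 e7 e8 e9.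
exists (X 0 0)%N, (Y 0 0)%N, (Z 0 0)%N.
by split=> // -[|[|[|[|a]]]] [|[|[|[|b]]]].
Qed.

Lemma sum_none m (F : nat -> K) (b : pred nat) :
  (forall a, (a < m)%N -> ~~ b a) -> \sum_(a <- iota 0 m) F a * (b a)%:R = 0.
Proof.
move=> bF; apply: big1_seq => a /=; rewrite mem_iota => /bF/negbTE->.
by rewrite mulr0.
Qed.

Lemma sum_only m (F : nat -> K) (b : pred nat) c :
    (c < m)%N -> (forall a, (a < m)%N -> b a = (a == c)) ->
  \sum_(a <- iota 0 m) F a * (b a)%:R = F c.
Proof.
move=> cm bE; rewrite (bigD1_seq c) ?mem_iota ?iota_uniq //= bE // eqxx mulr1.
rewrite big_seq_cond big1 ?addr0 // => a.
by rewrite mem_iota => /andP[/bE-> /negbTE->]; rewrite mulr0.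
Qed.

Lemma sum_iotaS m (F : nat -> K) (b : pred nat) :
  \sum_(a <- iota 0 m.+1) F a * (b a)%:R =
  \sum_(a <- iota 0 m) F a * (b a)%:R + F m * (b m)%:R.
Proof. by rewrite -addn1 iotaD big_cat big_seq1. Qed.

(* At step n the points given by the next three lemmas yield equations in which
   the entries X n i, Y n j, Z n k respectively are the only new unknowns. *)
Lemma obl_A i : exists j k, obl i j k /\
  forall n, (i < n -> 4 <= n -> j < n /\ k < n)%N.
Proof.
have [i4|i4] := leqP 4 i.
  by exists i, 0%N; rewrite obl_new; [split; lia | lia].
case: i i4 => [|[|[|[|//]]]] _;
  [exists 2%N, 3%N|exists 1%N, 3%N|exists 0%N, 2%N|exists 0%N, 1%N];
  by split=> //; lia.
Qed.

Lemma obl_B j : exists i k, [/\ obl i j k, k != 0%N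
  & forall n, (j < n -> 4 <= n -> i < n.-1 /\ k < n)%N].
Proof.
have [j4|j4] := leqP 4 j.
  by exists j.-1, j; rewrite obl_new; [split; lia | lia].
case: j j4 => [|[|[|[|//]]]] _;
  [exists 2%N, 2%N|exists 1%N, 3%N|exists 0%N, 3%N|exists 0%N, 2%N];
  by split=> //; lia.
Qed.

Lemma obl_C k : exists i j, [/\ obl i j k, j != 0%N
  & forall n, (k < n -> 4 <= n -> i < n.-1 /\ j < n)%N].
Proof.
have [k4|k4] := leqP 4 k.
  by exists k.-1, k; rewrite obl_new; [split; lia | lia].
case: k k4 => [|[|[|[|//]]]] _;
  [exists 2%N, 3%N|exists 1%N, 3%N|exists 0%N, 3%N|exists 0%N, 2%N];
  by split=> //; lia.
Qed.

Lemma obl_rigidS n : (4 <= n)%N -> obl_rigid n -> obl_rigid n.+1.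
Proof.
move=> n4 IHn X Y Z E.
(* Among triples with largest index [n], only [(n, n, 0)], [(n, 0, n)] and [(n - 1, n, n)] belong to
   the antichain; in particular none contains [n] exactly once. *)
have P0 : obl n n n = false by rewrite obl_new; lia.
have P1 k : (k < n)%N -> obl n n k = (k == 0%N) by rewrite obl_new; lia.
have P2 j : (j < n)%N -> obl n j n = (j == 0%N) by rewrite obl_new; lia.
have P3 i : (i < n)%N -> obl i n n = (i == n.-1) by rewrite obl_new; lia.
have N1 j k : (j < n)%N -> (k < n)%N -> obl n j k = false
  by rewrite obl_new; lia.
have N2 i k : (i < n)%N -> (k < n)%N -> obl i n k = false
  by rewrite obl_new; lia.
have N3 i j : (i < n)%N -> (j < n)%N -> obl i j n = false
  by rewrite obl_new; lia.
(* Hence the equations at old points contain no new unknown, and the induction hypothesis applies to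
   them. *)
have [x [y [z [xyz Xx Yy Zz]]]] : exists x y z,
    [/\ x + y + z = 0,
        scalar_upto n X x, scalar_upto n Y y & scalar_upto n Z z].
  apply: IHn => i j k im jm km; rewrite -[RHS](E i j k); try lia.
  by rewrite /oact !sum_iotaS N1 // N2 // N3 // !mulr0 !addr0.
(* The equations at points with exactly one index equal to [n]: one row sum, plus at most two
   entries from the new columns. *)
have EA j k : (j < n)%N -> (k < n)%N ->
    \sum_(a <- iota 0 n) X n a * (obl a j k)%:R
    + Y j n * (k == 0%N)%:R + Z k n * (j == 0%N)%:R = 0.
  move=> jn kn; rewrite -[RHS](E n j k (ltnSn n) (ltnW jn) (ltnW kn)).
  rewrite /oact !sum_iotaS.
  rewrite (sum_none (Y j)); last by move=> a an; rewrite N1.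
  rewrite (sum_none (Z k)); last by move=> a an; rewrite N1.
  by rewrite N1 // P1 // P2 // mulr0 addr0 !add0r.
have EB i k : (i < n)%N -> (k < n)%N ->
    \sum_(a <- iota 0 n) Y n a * (obl i a k)%:R
    + X i n * (k == 0%N)%:R + Z k n * (i == n.-1)%:R = 0.
  move=> jn kn; rewrite -[RHS](E i n k (ltnW jn) (ltnSn n) (ltnW kn)).
  rewrite /oact !sum_iotaS.
  rewrite (sum_none (X i)); last by move=> a an; rewrite N2.
  rewrite (sum_none (Z k)); last by move=> a an; rewrite N2.
  rewrite (N2 _ _ jn kn) P1 // P3 // mulr0 addr0 !add0r.
  by rewrite [X in _ = X + _]addrC.
have EC i j : (i < n)%N -> (j < n)%N ->
    \sum_(a <- iota 0 n) Z n a * (obl i j a)%:R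
    + X i n * (j == 0%N)%:R + Y j n * (i == n.-1)%:R = 0.
  move=> jn kn; rewrite -[RHS](E i j n (ltnW jn) (ltnW kn) (ltnSn n)).
  rewrite /oact !sum_iotaS.
  rewrite (sum_none (X i)); last by move=> a an; rewrite N3.
  rewrite (sum_none (Y j)); last by move=> a an; rewrite N3.
  by rewrite (N3 _ _ jn kn) P2 // P3 // mulr0 addr0 !add0r [RHS]addrC addrA.
have n0 : (0 < n)%N by lia.
have n1 : (n.-1 < n)%N by lia.
(* The point supplied by [obl_B] has [k != 0] and [i != n - 1], so both column terms of [EB] vanish
   and the row sum is the single entry [Y n b]. *)
have Yn b : (b < n)%N -> Y n b = 0.
  move=> bn; have [i [k [ik k0 /(_ n bn n4)[i1 kn]]]] := obl_B b.
  have := EB i k (ltn_trans i1 n1) kn.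
  rewrite (negbTE k0) (ltn_eqF i1) !mulr0 !addr0 (sum_only _ bn) // => a _.
  by apply/idP/eqP=> [/obl_freeB/(_ ik)|->].
have Zn c : (c < n)%N -> Z n c = 0.
  move=> cn; have [i [j [ij j0 /(_ n cn n4)[i1 jn]]]] := obl_C c.
  have := EC i j (ltn_trans i1 n1) jn.
  rewrite (negbTE j0) (ltn_eqF i1) !mulr0 !addr0 (sum_only _ cn) // => a _.
  by apply/idP/eqP=> [/obl_freeC/(_ ij)|->].
have zero_row (F : nat -> K) (b : pred nat) :
    (forall a, (a < n)%N -> F a = 0) ->
    \sum_(a <- iota 0 n) F a * (b a)%:R = 0.
  by move=> F0; apply: big1_seq => a /=; rewrite mem_iota => /F0->;
    rewrite mul0r.
have XZ i k : (i < n)%N -> (k < n)%N ->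
    X i n * (k == 0%N)%:R + Z k n * (i == n.-1)%:R = 0.
  by move=> iN kN; have := EB i k iN kN; rewrite zero_row // add0r.
have XY i j : (i < n)%N -> (j < n)%N ->
    X i n * (j == 0%N)%:R + Y j n * (i == n.-1)%:R = 0.
  by move=> iN jN; have := EC i j iN jN; rewrite zero_row // add0r.
have Yx : Y 0%N n = - X n.-1 n.
  apply/eqP; rewrite -addr_eq0 addrC.
  by have := XY _ _ n1 n0; rewrite !eqxx !mulr1 => ->.
have Zx : Z 0%N n = - X n.-1 n.
  apply/eqP; rewrite -addr_eq0 addrC.
  by have := XZ _ _ n1 n0; rewrite !eqxx !mulr1 => ->.
(* No triple [(a, 0, 0)] is in the antichain, so the equation at [(n, 0, 0)] reads
   [Y 0 n + Z 0 n = 0]. Both terms equal [- X n.-1 n], and 2 is invertible. *)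
have X10 : X n.-1 n = 0.
  have := EA 0%N 0%N n0 n0; rewrite !eqxx !mulr1 Yx Zx sum_none => [|a _].
    rewrite add0r -opprD -mulr2n => /eqP; rewrite oppr_eq0 -mulr_natr mulf_eq0.
    by rewrite (negbTE two_neq0) orbF => /eqP.
  by case: a => [|[|[|[|a]]]].
have Xi i : (i < n)%N -> X i n = 0.
  move=> iN; have [->//|i1] := eqVneq i n.-1.
  by have := XZ i 0%N iN n0; rewrite (negbTE i1) mulr0 mulr1 addr0.
have Yj j : (j < n)%N -> Y j n = 0.
  by move=> jn; have := XY _ j n1 jn; rewrite X10 eqxx mul0r mulr1 add0r.
have Zk k : (k < n)%N -> Z k n = 0.
  by move=> kn; have := XZ _ k n1 kn; rewrite X10 eqxx mul0r mulr1 add0r.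
(* With the new columns of [Y] and [Z] known to vanish, [EA] is left with one entry of the new row
   of [X]. *)
have Xn a : (a < n)%N -> X n a = 0.
  move=> an; have [j [k [jk /(_ n an n4)[jn kn]]]] := obl_A a.
  have := EA j k jn kn.
  rewrite Yj // Zk // !mul0r !addr0 (sum_only _ an) // => b _.
  by apply/idP/eqP=> [/obl_freeA/(_ jk)|->].
(* The three new triples give the equations for the new diagonal entries. Their deviations from [x],
   [y], [z] have all pairwise sums zero, hence vanish because 2 is invertible. *)
have eZ : X n n + Y n n + z = 0.
  have := E n n 0%N (ltnSn n) (ltnSn n) (ltnW n0); rewrite /oact !sum_iotaS.
  by rewrite (zero_row (X n)) // (zero_row (Y n)) // (P1 _ n0) P0
    ?eqxx ?mulr1 mulr0 !add0r addr0
    (sum_only _ n0 P1) Zz // ?eqxx ?mulr1.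
have eY : X n n + y + Z n n = 0.
  have := E n 0%N n (ltnSn n) (ltnW n0) (ltnSn n); rewrite /oact !sum_iotaS.
  by rewrite (zero_row (X n)) // (zero_row (Z n)) // (P2 _ n0) P0
    ?eqxx ?mulr1 mulr0 !add0r addr0
    (sum_only _ n0 P2) Yy // ?eqxx ?mulr1.
have eX : x + Y n n + Z n n = 0.
  have := E n.-1 n n (ltnW n1) (ltnSn n) (ltnSn n); rewrite /oact !sum_iotaS.
  by rewrite (zero_row (Y n)) // (zero_row (Z n)) // (P3 _ n1) P0
    ?eqxx ?mulr1 mulr0 !add0r addr0
    (sum_only _ n1 P3) Xx // ?eqxx ?mulr1.
have half (u : K) : u *+ 2 = 0 -> u = 0.
  by move/eqP; rewrite -mulr_natr mulf_eq0 (negbTE two_neq0) orbF => /eqP.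
have Xnn : X n n = x.
  apply/subr0_eq/half; rewrite [LHS](_ : _ =
    (X n n + Y n n + z) + (X n n + y + Z n n) - (x + Y n n + Z n n)
    - (x + y + z)); last by ring.
  by rewrite eX eY eZ xyz !subr0 addr0.
have Ynn : Y n n = y.
  apply/subr0_eq; rewrite [LHS](_ : _ =
    (X n n + Y n n + z) - (x + y + z) - (X n n - x)); last by ring.
  by rewrite eZ xyz Xnn !subrr.
have Znn : Z n n = z.
  apply/subr0_eq; rewrite [LHS](_ : _ =
    (X n n + y + Z n n) - (x + y + z) - (X n n - x)); last by ring.
  by rewrite eY xyz Xnn !subrr.
have ext V v : scalar_upto n V v -> (forall a, (a < n)%N -> V n a = 0) ->
    (forall a, (a < n)%N -> V a n = 0) -> V n n = v -> scalar_upto n.+1 V v.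
  move=> Vv Vn nV Vnn a b.
  rewrite [(a < _)%N]leq_eqVlt [(b < _)%N]leq_eqVlt !eqSS.
  move=> /predU1P[->|an] /predU1P[->|bn];
    rewrite ?eqxx ?mulr1n //; last exact: Vv.
  - by rewrite gtn_eqF // Vn.
  - by rewrite ltn_eqF // nV.
by exists x, y, z; split=> //; apply: ext.
Qed.

Lemma obl_rigid_ge4 m : (4 <= m)%N -> obl_rigid m.
Proof.
move=> m4; rewrite -(subnK m4); elim: (m - 4)%N => [|d IHd].
  exact: obl_rigid4.
by apply: obl_rigidS IHd; rewrite leq_addl.
Qed.

End Annihilator.

(** * Tight, oblique and rigid tensors *)

Section Subsets.
Variable m : nat.

Lemma total_order_inj d (V : orderType d) (f : 'I_m -> V) :
  injective f -> total_order (fun i j => (f i <= f j)%O).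
Proof.
move=> f_inj; split=> [i|i j /le_anti/f_inj//|i j k|i j]; first exact: lexx.
  exact: le_trans.
exact: le_total.
Qed.

(** Order each factor by its weights. For comparable points the three weight differences have the
    same sign and sum to zero, so all vanish, and injectivity makes the points equal. *)
Lemma tight_set_oblique (S : {set triple m}) : tight_set S -> oblique_set S.
Proof.
case=> Sc [tA [tB [tC [injA injB injC S0]]]]; split=> //.
exists (fun i j => tA i <= tA j), (fun i j => tB i <= tB j),
  (fun i j => tC i <= tC j).
split; do ?exact: total_order_inj.
have ltS p q : p \in S -> q \in S -> p != q ->
    ~~ prod_order (fun i j => tA i <= tA j) (fun i j => tB i <= tB j)
         (fun i j => tC i <= tC j) p q.
  case: p q => [[i j] k] [[i' j'] k'] /S0 Sp /S0 Sq; apply: contra.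
  case/and3P=> /= le_i le_j le_k; apply/eqP.
  by congr (_, _, _); [apply: injA|apply: injB|apply: injC]; lia.
by move=> p q pS qS neq_pq; split; apply: ltS; rewrite // eq_sym.
Qed.

End Subsets.

(** * Infinitesimal symmetries, rigidity and conciseness *)

Section Symmetries.
Variables (K : numFieldType) (m : nat).
Implicit Types (T : tensor K m) (X Y Z : 'M[K]_m).

(** The Leibniz action of the Lie algebra of triples of matrices: the derivative at [t = 0] of
    applying [1 + t X], [1 + t Y], [1 + t Z] to the three factors. *)
Definition sym_act X Y Z T : tensor K m :=
  [ffun p => \sum_i X p.1.1 i * T (i, p.1.2, p.2)
             + \sum_i Y p.1.2 i * T (p.1.1, i, p.2)
             + \sum_i Z p.2 i * T (p.1.1, p.1.2, i)].

(** Scalar triples of sum zero annihilate every tensor, so this says that the annihilator is as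
    small as possible. *)
Definition rigid T : Prop := forall X Y Z, (forall p, sym_act X Y Z T p = 0) ->
  exists x y z, [/\ x + y + z = 0, X = x%:M, Y = y%:M & Z = z%:M].

Lemma sym_act_scalar x y z T p :
  sym_act x%:M y%:M z%:M T p = (x + y + z) * T p.
Proof.
have sumE (c : K) a (F : 'I_m -> K) : \sum_i c%:M a i * F i = c * F a.
  rewrite (bigD1 a) //= mxE eqxx mulr1n big1 ?addr0 // => i ia.
  by rewrite mxE eq_sym (negbTE ia) mul0r.
by case: p => [[i j] k]; rewrite ffunE /= !sumE -!mulrDl.
Qed.

Lemma sym_actD X Y Z X' Y' Z' T p :
  sym_act (X + X') (Y + Y') (Z + Z') T p
  = sym_act X Y Z T p + sym_act X' Y' Z' T p.
Proof.
rewrite !ffunE addrACA [X in _ = X + _]addrACA.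
by congr (_ + _ + _); rewrite -big_split; apply: eq_bigr => i _;
  rewrite mxE mulrDl.
Qed.

Lemma sym_actZ c X Y Z T p :
  sym_act (c *: X) (c *: Y) (c *: Z) T p = c * sym_act X Y Z T p.
Proof.
rewrite !ffunE !mulrDr !mulr_sumr.
by congr (_ + _ + _); apply: eq_bigr => i _; rewrite mxE mulrA.
Qed.

Hypothesis m_gt1 : (1 < m)%N.

Lemma ord_neq (i : 'I_m) : exists j : 'I_m, j != i.
Proof.
have m0 : (0 < m)%N by apply: leq_trans m_gt1.
have [i0|i0] := eqVneq i (Ordinal m0).
  by exists (Ordinal m_gt1); rewrite i0.
by exists (Ordinal m0); rewrite eq_sym.
Qed.

Lemma const_rows_scalar (w : 'rV[K]_m) x : (\matrix_(l < m) w = x%:M) -> w = 0.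
Proof.
move=> wx; apply/rowP=> i; have [l li] := ord_neq i.
by have /matrixP/(_ l i) := wx; rewrite !mxE (negbTE li).
Qed.

(* A form killed by T, repeated in every row, is an infinitesimal symmetry. *)
Lemma rigid_concise T : rigid T -> concise T.
Proof.
move=> Tr; split=> u v.
- move=> Tuv; apply/subr0_eq.
  have [|x [y [z [_ /const_rows_scalar//]]]] :=
    Tr (\matrix_(l < m) (u - v)) 0 0.
  case=> [[i j] k]; rewrite ffunE /=.
  rewrite [X in _ + X + _]big1 => [|l _]; last by rewrite mxE mul0r.
  rewrite [X in _ + X]big1 => [|l _]; last by rewrite mxE mul0r.
  have /matrixP/(_ j k) := Tuv; rewrite !mxE !addr0 => /eqP.
  rewrite -subr_eq0 -sumrB => /eqP E.
  by rewrite -[RHS]E; apply: eq_bigr => l _; rewrite !mxE mulrBl.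
- move=> Tuv; apply/subr0_eq.
  have [|x [y [z [_ _ /const_rows_scalar//]]]] :=
    Tr 0 (\matrix_(l < m) (u - v)) 0.
  case=> [[i j] k]; rewrite ffunE /=.
  rewrite [X in X + _ + _]big1 => [|l _]; last by rewrite mxE mul0r.
  rewrite [X in _ + X]big1 => [|l _]; last by rewrite mxE mul0r.
  have /matrixP/(_ i k) := Tuv; rewrite !mxE addr0 add0r => /eqP.
  rewrite -subr_eq0 -sumrB => /eqP E.
  by rewrite -[RHS]E; apply: eq_bigr => l _; rewrite !mxE mulrBl.
- move=> Tuv; apply/subr0_eq.
  have [|x [y [z [_ _ _ /const_rows_scalar//]]]] :=
    Tr 0 0 (\matrix_(l < m) (u - v)).
  case=> [[i j] k]; rewrite ffunE /=.
  rewrite [X in X + _ + _]big1 => [|l _]; last by rewrite mxE mul0r.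
  rewrite [X in _ + X + _]big1 => [|l _]; last by rewrite mxE mul0r.
  have /matrixP/(_ i j) := Tuv; rewrite !mxE !add0r => /eqP.
  rewrite -subr_eq0 -sumrB => /eqP E.
  by rewrite -[RHS]E; apply: eq_bigr => l _; rewrite !mxE mulrBl.
Qed.

Lemma delta_neq0 (i : 'I_m) : delta_mx 0 i != 0 :> 'rV[K]_m.
Proof. by apply/eqP=> /rowP/(_ i)/eqP; rewrite !mxE !eqxx oner_eq0. Qed.

(** If an index were missing from a projection of the support, the corresponding dual basis vector
    would be killed by the flattening. *)
Lemma concise_supp T : concise T -> concise_set (tensor_supp T).
Proof.
have flat0 (flat : tensor K m -> 'rV[K]_m -> 'M[K]_m) i :
    injective (flat T) -> flat T (delta_mx 0 i) = flat T 0 -> False.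
  by move=> inj /inj/eqP; rewrite (negbTE (delta_neq0 i)).
case=> injA injB injC; split; apply/setP=> i; rewrite inE; apply/imsetP;
  apply: contrapT => Ni.
- apply: (flat0 _ i injA); apply/matrixP=> j k; rewrite !mxE.
  apply: eq_bigr => l _; rewrite !mxE /= mul0r.
  have [->|] := eqVneq l i; last by rewrite mul0r.
  apply/eqP; rewrite mul1r; apply: contra_notT Ni => Tn; exists (i, j, k) => //.
  by rewrite inE.
- apply: (flat0 _ i injB); apply/matrixP=> j k; rewrite !mxE.
  apply: eq_bigr => l _; rewrite !mxE /= mul0r.
  have [->|] := eqVneq l i; last by rewrite mul0r.
  apply/eqP; rewrite mul1r; apply: contra_notT Ni => Tn; exists (j, i, k) => //.
  by rewrite inE.
- apply: (flat0 _ i injC); apply/matrixP=> j k; rewrite !mxE.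
  apply: eq_bigr => l _; rewrite !mxE /= mul0r.
  have [->|] := eqVneq l i; last by rewrite mul0r.
  apply/eqP; rewrite mul1r; apply: contra_notT Ni => Tn; exists (j, k, i) => //.
  by rewrite inE.
Qed.

Lemma free_unitmx (a : m.-tuple 'rV[K]_m) :
  free a = (\matrix_i tnth a i \in unitmx).
Proof.
rewrite -row_free_unit; apply/freeP/idP => [a_free|a_free c c0 i].
  apply: inj_row_free => v v0; apply/rowP=> i; rewrite mxE.
  apply: (a_free (v 0)); rewrite -[RHS]v0 mulmx_sum_row.
  by apply: eq_bigr => l _; rewrite rowK (tnth_nth 0).
have /rowP/(_ i) : \row_l c l = 0; last by rewrite !mxE.
apply: (row_free_inj a_free); rewrite mul0mx -[RHS]c0 mulmx_sum_row.
by apply: eq_bigr => l _; rewrite rowK (tnth_nth 0) mxE.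
Qed.

Lemma std_basis : basis_of fullv [tuple delta_mx 0 i : 'rV[K]_m | i < m].
Proof.
rewrite basisEfree subvf dimvf size_tuple free_unitmx.
apply/and3P; split=> //; last by rewrite dim_matrix mul1r.
rewrite (_ : \matrix_i _ = 1%:M) ?unitmx1 //; apply/matrixP=> i j.
by rewrite mxE tnth_mktuple !mxE eqxx eq_sym.
Qed.

Lemma tensor_in_std T : T = tensor_in
  [tuple delta_mx 0 i : 'rV[K]_m | i < m]
  [tuple delta_mx 0 i : 'rV[K]_m | i < m]
  [tuple delta_mx 0 i : 'rV[K]_m | i < m] T.
Proof.
apply/ffunP=> q; rewrite ffunE (bigD1 q) //= big1 => [|p pq].
  by rewrite ffunE !tnth_mktuple !mxE !eqxx !mulr1 addr0.
rewrite ffunE !tnth_mktuple !mxE !eqxx /=.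
case: p q pq => [[i j] k] [[i' j'] k'] /=; rewrite !xpair_eqE.
rewrite ![_ == i']eq_sym ![_ == j']eq_sym ![_ == k']eq_sym.
by do 3!case: eqP => _ //=; rewrite ?mulr0 ?mul0r ?mulr0.
Qed.

End Symmetries.

(** * The rigid oblique tensor *)

Section OblTensor.
Variables (K : numFieldType) (m : nat).
Hypothesis m_ge4 : (4 <= m)%N.

Definition obl_tensor : tensor K m :=
  [ffun p : triple m => (obl p.1.1 p.1.2 p.2)%:R].

Lemma obl_tensor_rigid : rigid obl_tensor.
Proof.
have m_gt0 : (0 < m)%N by apply: leq_trans m_ge4.
(* Indices outside the range are sent to 0; the extended matrices are only read below [m]. *)
move=> X Y Z E; pose ord a : 'I_m := insubd (Ordinal m_gt0) a.
have ordK (i : 'I_m) : ord i = i by exact: valKd.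
have ord_lt a : (a < m)%N -> ord a = a :> nat.
  by move=> am; rewrite /ord val_insubd am.
pose ext (V : 'M[K]_m) a b := V (ord a) (ord b).
have sumE (V : 'M[K]_m) a (b : pred nat) :
    \sum_(c <- iota 0 m) ext V a c * (b c)%:R = \sum_i V (ord a) i * (b i)%:R.
  rewrite -[in LHS](subn0 m) big_mkord; apply: eq_bigr => i _.
  by rewrite /ext ordK.
have two_neq0 : 2%:R != 0 :> K by rewrite pnatr_eq0.
have [|x [y [z [xyz Xx Yy Zz]]]] :=
    obl_rigid_ge4 two_neq0 m_ge4 (X := ext X) (Y := ext Y) (Z := ext Z).
  move=> i j k im jm km; rewrite -[RHS](E (ord i, ord j, ord k)).
  rewrite /oact !sumE ffunE /=.
  by congr (_ + _ + _); apply: eq_bigr => a _;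
    rewrite ffunE /= ?(ord_lt i) ?(ord_lt j) ?(ord_lt k).
have scalarE (V : 'M[K]_m) v : scalar_upto m (ext V) v -> V = v%:M.
  move=> Vv; apply/matrixP=> i j; rewrite mxE -(Vv i j) ?ltn_ord //.
  by rewrite /ext !ordK.
by exists x, y, z; split=> //; apply: scalarE.
Qed.

Lemma obl_tensor_oblique : Oblique obl_tensor.
Proof.
have m_gt1 : (1 < m)%N by apply: leq_trans m_ge4.
have T_concise := rigid_concise m_gt1 obl_tensor_rigid.
split=> //; exists [tuple delta_mx 0 i | i < m], [tuple delta_mx 0 i | i < m],
  [tuple delta_mx 0 i | i < m], obl_tensor.
split; try exact: std_basis; first exact: tensor_in_std.
split; first exact: concise_supp.
have pos_inj : injective (fun i : 'I_m => obl_pos m i).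
  by move=> i j /obl_pos_inj ij; apply/val_inj/ij; apply: ltn_ord.
exists (fun i j => (i <= j)%O), (fun i j => (obl_pos m i <= obl_pos m j)%O),
  (fun i j => (obl_pos m i <= obl_pos m j)%O).
split; try exact: total_order_inj.
suff incomp p q :
    p \in tensor_supp obl_tensor -> q \in tensor_supp obl_tensor ->
    prod_order (fun i j => (i <= j)%O)
      (fun i j => (obl_pos m i <= obl_pos m j)%O)
      (fun i j => (obl_pos m i <= obl_pos m j)%O) p q -> p = q.
  move=> p q pS qS pq.
  by split; apply: contra pq => /incomp-> //.
rewrite !inE !ffunE !pnatr_eq0 !eqb0 !negbK.
case: p q => [[i j] k] [[i' j'] k'] /= Sp Sq /and3P[/= le_i le_j le_k].
have [ii' [jj' kk']] := obl_antichain (ltn_ord j) (ltn_ord k) (ltn_ord j')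
  (ltn_ord k') Sp Sq le_i le_j le_k.
by congr (_, _, _); apply: val_inj.
Qed.

End OblTensor.

(** * The non-scalar symmetry of a tight tensor *)

Section TightSymmetry.
Variables (K : numFieldType) (m : nat).
Hypothesis m_gt1 : (1 < m)%N.
Implicit Types T : tensor K m.

(** The operator with eigenvectors [a] and eigenvalues [t]. It is transposed because the basis
    vectors are the rows of [P], while [sym_act] multiplies columns of coordinates on the left. *)
Definition weight_mx (a : m.-tuple 'rV[K]_m) (t : 'I_m -> int) : 'M[K]_m :=
  let P := \matrix_i tnth a i in
  (invmx P *m diag_mx (\row_i (t i)%:~R) *m P)^T.

Lemma weight_mxE (a : m.-tuple 'rV[K]_m) (t : 'I_m -> int) i l :
    basis_of fullv a ->
  \sum_j weight_mx a t l j * tnth a i 0 j = (t i)%:~R * tnth a i 0 l.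
Proof.
move=> /basis_free; rewrite free_unitmx; set P := \matrix_i _ => P_unit.
have /matrixP/(_ i l) : P *m (weight_mx a t)^T =
    diag_mx (\row_i (t i)%:~R) *m P.
  by rewrite trmxK -/P !mulmxA mulmxV // mul1mx.
rewrite mul_diag_mx !mxE => <-.
by apply: eq_bigr => j _; rewrite mulrC !mxE.
Qed.

Lemma weight_mx_nonscalar (a : m.-tuple 'rV[K]_m) (t : 'I_m -> int) x :
  basis_of fullv a -> injective t -> weight_mx a t <> x%:M.
Proof.
move=> /basis_free; rewrite free_unitmx => P_unit t_inj /(congr1 trmx).
rewrite trmxK tr_scalar_mx; set P := \matrix_i _; set D := diag_mx _ => PDP.
have /matrixP Dx : D = x%:M.
  have <- : P *m (invmx P *m D *m P) *m invmx P = D.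
    by rewrite !mulmxA mulmxV // mul1mx -mulmxA mulmxV // mulmx1.
  by rewrite PDP mul_mx_scalar -scalemxAl mulmxV // scalemx1.
have tx i : (t i)%:~R = x by have := Dx i i; rewrite !mxE eqxx !mulr1n.
pose i := Ordinal (ltnW m_gt1); have [j] := ord_neq m_gt1 i.
by apply/negP; rewrite negbK; apply/eqP/t_inj/(@intr_inj K); rewrite !tx.
Qed.

(** Each basis tensor is an eigenvector of the action, with eigenvalue the sum of its three weights,
    which is zero on the support. Injective weights on at least two indices are not constant, so the
    first matrix is not scalar. *)
Lemma tight_symmetry T : tight T ->
  exists X Y Z, (forall p, sym_act X Y Z T p = 0) /\ forall x, X <> x%:M.
Proof.
case=> a [b [c [W [a_basis b_basis c_basis ->]]]].
case=> _ [tA [tB [tC [injA injB injC W0]]]].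
exists (weight_mx a tA), (weight_mx b tB), (weight_mx c tC).
split=> [q|x]; last exact: weight_mx_nonscalar.
pose e (p : triple m) := pure_tensor (tnth a p.1.1) (tnth b p.1.2) (tnth c p.2).
have swap (V : 'M[K]_m) i0 (g : 'I_m -> triple m) :
    \sum_i V i0 i * tensor_in a b c W (g i) =
    \sum_p W p * \sum_i V i0 i * e p (g i).
  transitivity (\sum_i \sum_p W p * (V i0 i * e p (g i))).
    apply: eq_bigr => i _; rewrite ffunE mulr_sumr.
    by apply: eq_bigr => p _; rewrite mulrCA.
  by rewrite exchange_big; apply: eq_bigr => p _; rewrite mulr_sumr.
rewrite ffunE !swap -!big_split big1 // => p _ /=; rewrite -!mulrDr.
have [->|Wp] := eqVneq (W p) 0; first by rewrite mul0r.
set u := tnth a p.1.1; set v := tnth b p.1.2; set w := tnth c p.2.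
have SA : \sum_i weight_mx a tA q.1.1 i * e p (i, q.1.2, q.2)
    = (tA p.1.1)%:~R * e p q.
  transitivity ((\sum_i weight_mx a tA q.1.1 i * u 0 i)
    * (v 0 q.1.2 * w 0 q.2)).
    by rewrite mulr_suml; apply: eq_bigr => i _; rewrite ffunE /=; ring.
  by rewrite weight_mxE // ffunE; ring.
have SB : \sum_i weight_mx b tB q.1.2 i * e p (q.1.1, i, q.2)
    = (tB p.1.2)%:~R * e p q.
  transitivity ((\sum_i weight_mx b tB q.1.2 i * v 0 i)
    * (u 0 q.1.1 * w 0 q.2)).
    by rewrite mulr_suml; apply: eq_bigr => i _; rewrite ffunE /=; ring.
  by rewrite weight_mxE // ffunE; ring.
have SC : \sum_i weight_mx c tC q.2 i * e p (q.1.1, q.1.2, i)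
    = (tC p.2)%:~R * e p q.
  transitivity ((\sum_i weight_mx c tC q.2 i * w 0 i)
    * (u 0 q.1.1 * v 0 q.1.2)).
    by rewrite mulr_suml; apply: eq_bigr => i _; rewrite ffunE /=; ring.
  by rewrite weight_mxE // ffunE; ring.
rewrite SA SB SC -!mulrDl -!intrD (W0 p.1.1 p.1.2 p.2) ?mul0r ?mulr0 //.
by case: p Wp {SA SB SC u v w} => [[i j] k] Wp; rewrite inE.
Qed.

End TightSymmetry.

(** * Closures *)

Section Closures.
Variables (K : numFieldType) (m : nat).
Implicit Types (T : tensor K m) (g : tensor K m -> K).

Definition polyfun g := exists f : mpoly.mpoly #|triple m| K,
  forall T, mpoly.meval (tensor_vec T 0) f = g T.

Lemma polyfun_eq g h : g =1 h -> polyfun g -> polyfun h.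
Proof. by move=> gh [f fE]; exists f => T; rewrite fE. Qed.

Lemma polyfun_cst c : polyfun (fun=> c).
Proof. by exists (mpoly.mpolyC _ c) => T; rewrite mpoly.mevalC. Qed.

Lemma polyfun_coord p : polyfun (fun T => T p).
Proof.
exists (mpoly.mpolyX K (mpoly.mnm1 (enum_rank p))) => T.
by rewrite mpoly.mevalXU mxE enum_rankK.
Qed.

Lemma polyfunD g h : polyfun g -> polyfun h -> polyfun (fun T => g T + h T).
Proof.
by case=> f fE [f' fE']; exists (f + f') => T; rewrite mpoly.mevalD fE fE'. Qed.

Lemma polyfunM g h : polyfun g -> polyfun h -> polyfun (fun T => g T * h T).
Proof.
by case=> f fE [f' fE']; exists (f * f') => T; rewrite mpoly.mevalM fE fE'. Qed.

Lemma polyfun_sum I (r : seq I) (G : I -> tensor K m -> K) :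
  (forall i, polyfun (G i)) -> polyfun (fun T => \sum_(i <- r) G i T).
Proof.
move=> GP; elim: r => [|i r IHr].
  by apply: polyfun_eq (polyfun_cst 0) => T; rewrite big_nil.
by apply: polyfun_eq (polyfunD (GP i) IHr) => T; rewrite big_cons.
Qed.

Lemma polyfun_prod I (r : seq I) (G : I -> tensor K m -> K) :
  (forall i, polyfun (G i)) -> polyfun (fun T => \prod_(i <- r) G i T).
Proof.
move=> GP; elim: r => [|i r IHr].
  by apply: polyfun_eq (polyfun_cst 1) => T; rewrite big_nil.
by apply: polyfun_eq (polyfunM (GP i) IHr) => T; rewrite big_cons.
Qed.

(** By the Leibniz expansion: a sum over permutations of a constant sign times a product of
    entries. *)
Lemma polyfun_det n (A : tensor K m -> 'M[K]_n) :
  (forall i j, polyfun (fun T => A T i j)) -> polyfun (fun T => \det (A T)).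
Proof.
move=> AP; apply: polyfun_sum => s; apply: polyfunM; first exact: polyfun_cst.
by apply: polyfun_prod => i; apply: AP.
Qed.

Lemma zariski_closureS (X Y : set (tensor K m)) :
  (X `<=` Y)%classic -> (zariski_closure X `<=` zariski_closure Y)%classic.
Proof. by move=> XY T XT f f0; apply: XT => S /XY; apply: f0. Qed.

Lemma sub_zariski_closure (X : set (tensor K m)) :
  (X `<=` zariski_closure X)%classic.
Proof. by move=> T XT f; apply. Qed.

Lemma Tight_sub_Oblique : (@Tight K m `<=` @Oblique K m)%classic.
Proof.
move=> T [Tc [a [b [c [W [Ha Hb Hc TW /tight_set_oblique WO]]]]]].
by split=> //; exists a, b, c, W.
Qed.

End Closures.

(** * Rigid tensors lie outside the Zariski closure of the tight ones *)

Section Rigidity.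
Variables (K : numFieldType) (n : nat).
Local Notation m := n.+1.
Local Notation N := (m * m + (m * m + m * m))%N.
Implicit Types (T : tensor K m) (v : 'rV[K]_N).

(** A triple of matrices is coded as one row vector, so that the annihilator becomes the left kernel
    of a single matrix. *)
Definition partA v : 'M[K]_m := vec_mx (lsubmx v).
Definition partB v : 'M[K]_m := vec_mx (lsubmx (rsubmx v)).
Definition partC v : 'M[K]_m := vec_mx (rsubmx (rsubmx v)).

(* The last two coordinates cut the scalar triples (x, y, - x - y), which
   annihilate every tensor, down to zero. *)
Definition gauged_act T v : 'rV[K]_(#|triple m| + (1 + 1)) :=
  row_mx (tensor_vec (sym_act (partA v) (partB v) (partC v) T))
         (row_mx (partA v 0 0)%:M (partB v 0 0)%:M).

Lemma gauged_act_linear T : linear (gauged_act T).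
Proof.
move=> c u v; rewrite /gauged_act.
have [-> -> ->] : [/\ partA (c *: u + v) = c *: partA u + partA v,
    partB (c *: u + v) = c *: partB u + partB v
    & partC (c *: u + v) = c *: partC u + partC v].
  by rewrite /partA /partB /partC !linearP.
rewrite !scale_row_mx !add_row_mx; congr (row_mx _ (row_mx _ _)).
- by apply/rowP=> i; rewrite !mxE sym_actD sym_actZ.
- by rewrite !mxE raddfD /= -scale_scalar_mx.
- by rewrite !mxE raddfD /= -scale_scalar_mx.
Qed.

Definition act_mx T : 'M[K]_(N, #|triple m| + (1 + 1)) :=
  lin1_mx (gauged_act T).

Lemma mul_act_mx T v : v *m act_mx T = gauged_act T v.
Proof.
pose L := GRing.isLinear.Build _ _ _ _ _ (gauged_act_linear T).
pose f : {linear 'rV[K]_N -> 'rV[K]_(#|triple m| + (1 + 1))} :=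
  HB.pack (gauged_act T) L.
exact: (mul_rV_lin1 f).
Qed.

Lemma gauged_act_eq0 T v : gauged_act T v = 0 <->
  [/\ forall p, sym_act (partA v) (partB v) (partC v) T p = 0,
      partA v 0 0 = 0 & partB v 0 0 = 0].
Proof.
rewrite /gauged_act; split=> [|[T0 A0 B0]].
  rewrite -[0 in RHS]row_mx0 => /eq_row_mx[/rowP T0].
  rewrite -[0 in RHS]row_mx0 => /eq_row_mx[/rowP/(_ 0) A0 /rowP/(_ 0) B0].
  split; [|by move: A0; rewrite !mxE|by move: B0; rewrite !mxE].
  by move=> p; have := T0 (enum_rank p); rewrite !mxE enum_rankK.
rewrite A0 B0 raddf0 row_mx0 (_ : tensor_vec _ = 0) ?row_mx0 //.
by apply/rowP=> i; rewrite !mxE T0.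
Qed.

(** The entries are linear in [T], except in the last two columns, where they are constant. *)
Lemma polyfun_act_mx i j : polyfun (fun T => act_mx T i j).
Proof.
pose v : 'rV[K]_N := delta_mx 0 i.
suff : polyfun (fun T => gauged_act T v 0 j).
  by apply: polyfun_eq => T; rewrite !mxE.
rewrite /gauged_act; case: (splitP j) => [k jk|k jk].
  have -> : j = lshift _ k by apply: val_inj.
  suff : polyfun (fun T =>
      sym_act (partA v) (partB v) (partC v) T (enum_val k)).
    by apply: polyfun_eq => T; rewrite row_mxEl mxE.
  apply: (@polyfun_eq _ _ (fun T => _ + _ + _)) => [T|]; first by rewrite ffunE.
  apply: polyfunD; first apply: polyfunD; apply: polyfun_sum => l;
  exact: polyfunM (polyfun_cst _ _) (polyfun_coord _ _).
have -> : j = rshift _ k by apply: val_inj.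
by apply: polyfun_eq (polyfun_cst _ _) => T; rewrite row_mxEr.
Qed.

Lemma rigid_act_mx T : (0 < n)%N -> rigid T -> row_free (act_mx T).
Proof.
move=> n0 Tr; apply: inj_row_free => v; rewrite mul_act_mx.
case/gauged_act_eq0=> /Tr[x [y [z [xyz Ax By Cz]]]].
rewrite Ax By !mxE eqxx !mulr1n => x0 y0.
rewrite -[v]hsubmxK -[rsubmx v]hsubmxK -[lsubmx v]vec_mxK.
rewrite -[lsubmx (rsubmx v)]vec_mxK -[rsubmx (rsubmx v)]vec_mxK.
rewrite -/(partA v) -/(partB v) -/(partC v).
move: xyz Ax By Cz; rewrite x0 y0 !add0r => -> -> -> ->.
by rewrite !raddf0 !row_mx0.
Qed.

Lemma tight_act_mx T : (0 < n)%N -> tight T ->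
  exists2 v : 'rV[K]_N, v != 0 & v *m act_mx T = 0.
Proof.
move=> n0 /tight_symmetry[|X [Y [Z [E X_nonscalar]]]]; first by rewrite ltnS.
(* Subtracting the scalar triple [(x, y, - x - y)] meets the gauge conditions and keeps a symmetry,
   non-zero since [X] is not scalar. *)
pose x := X 0 0; pose y := Y 0 0.
pose v : 'rV[K]_N := row_mx (mxvec (X - x%:M))
  (row_mx (mxvec (Y - y%:M)) (mxvec (Z + (x + y)%:M))).
have [vA vB vC] : [/\ partA v = X - x%:M, partB v = Y - y%:M
    & partC v = Z + (x + y)%:M].
  by rewrite /partA /partB /partC !(row_mxKl, row_mxKr) !mxvecK.
exists v; last first.
  rewrite mul_act_mx; apply/gauged_act_eq0; rewrite vA vB vC.
  split=> [p||]; try by rewrite !mxE eqxx mulr1n subrr.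
  rewrite -!raddfN /= sym_actD E sym_act_scalar.
  by rewrite -opprD addNr mul0r addr0.
apply/eqP=> v0; apply: (X_nonscalar x); apply/subr0_eq.
by rewrite -vA v0 /partA !raddf0.
Qed.

(** For a right inverse [B] of [act_mx T], the polynomial [\det (act_mx S *m B)] in [S] is 1 at [T]
    and vanishes on tight tensors, where the left kernel is non-zero. *)
Lemma rigid_not_zariski_Tight T :
  (0 < n)%N -> rigid T -> ~ zariski_closure (@Tight K m) T.
Proof.
move=> n0 /(rigid_act_mx n0)/row_freeP[B TB].
(* Composing with a right inverse at T replaces the choice of a minor. *)
have [i j|f fE] := @polyfun_det K m N (fun S => act_mx S *m B).
  apply: polyfun_eq (fun S => esym (mxE _ _ _ _)) _.
  apply: polyfun_sum => k.
  exact: polyfunM (polyfun_act_mx i k) (polyfun_cst _ _).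
move=> /(_ f); rewrite fE TB det1 => T_f.
suff /T_f/eqP : forall S, Tight S -> mpoly.meval (tensor_vec S 0) f = 0.
  by rewrite oner_eq0.
move=> S [_ /(tight_act_mx n0)[v v0 vS]]; rewrite fE; apply/eqP/det0P.
by exists v; rewrite // mulmxA vS mul0mx.
Qed.

End Rigidity.

(** * Comparison of the Euclidean and Zariski closures *)

Section Euclidean.
Import numFieldNormedType.Exports.
Local Open Scope classical_set_scope.

Lemma meval_continuous (K : numFieldType) N (f : mpoly.mpoly N K) :
  continuous (fun v : 'rV[K^o]_N => mpoly.meval (v 0) f : K^o).
Proof.
have cstP (c : K) : continuous (fun _ : 'rV[K^o]_N => c : K^o)
  by move=> v; apply: cst_continuous.
elim/mpoly.mpolyind: f => [|c e f _ _ IHf].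
  rewrite (_ : (fun v => _) = fun=> 0); first exact: cstP.
  by apply/funext => v; rewrite mpoly.meval0.
rewrite (_ : (fun v => _) = fun v : 'rV[K^o]_N =>
  c * (\prod_(i <- enum 'I_N) (v 0 i : K^o) ^+ e i) + mpoly.meval (v 0) f
  : K^o).
  move=> v; apply: continuousD (IHf v); apply: continuousM; first exact: cstP.
  elim: (enum _) => [|i s IHs] in v *.
    rewrite (_ : (fun v => _) = fun=> 1); first exact: cstP.
    by apply/funext => w; rewrite big_nil.
  rewrite (_ : (fun v => _) = fun w : 'rV[K^o]_N =>
     (w 0 i : K^o) ^+ e i * \prod_(j <- s) (w 0 j : K^o) ^+ e j : K^o).
    apply: continuousM; last exact: IHs.
    elim: (e i) => [|d IHd].
      rewrite (_ : (fun v => _) = fun=> 1); first exact: cstP.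
      by apply/funext => w; rewrite expr0.
    rewrite (_ : (fun v => _) = fun w : 'rV[K^o]_N =>
       (w 0 i : K^o) * (w 0 i : K^o) ^+ d : K^o).
      by apply: continuousM IHd; exact: coord_continuous.
    by apply/funext => w; rewrite exprS.
  by apply/funext => w; rewrite big_cons.
apply/funext => v; rewrite mpoly.mevalD mpoly.mevalZ mpoly.mevalX.
by rewrite big_enum.
Qed.

Variables (R : realType) (m : nat).
Implicit Types X Y : set (tensor (complex R) m).

Lemma sub_euclidean_closure X : X `<=` euclidean_closure X.
Proof. by move=> T XT; apply: subset_closure; exists T. Qed.

Lemma euclidean_closureS X Y :
  X `<=` Y -> euclidean_closure X `<=` euclidean_closure Y.
Proof. by move=> XY T; apply: closureS; apply: image_subset. Qed.

(** The zero locus of a polynomial is closed by continuity, so it contains the closure of any set on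
    which the polynomial vanishes. *)
Lemma euclidean_sub_zariski X : euclidean_closure X `<=` zariski_closure X.
Proof.
move=> T XT f f0.
pose h (v : 'rV[(complex R)^o]_#|triple m|) := mpoly.meval (v 0) f.
have h_closed : closed (h @^-1` [set 0 : (complex R)^o]).
  apply: preimage_closed; last first.
    by apply/accessible_closed_set1/hausdorff_accessible; apply: norm_hausdorff.
  by move=> v _; apply: meval_continuous.
suff : (h @^-1` [set 0]) (tensor_vec T) by [].
have /closure_id -> := h_closed.
by apply: closureS XT => _ [S XS <-]; exact: f0.
Qed.

End Euclidean.

Theorem mainTheorem7 (R : realType) (m : nat) (hm : (4 <= m)%N) :
  (zariski_closure (@Tight (complex R) m) `<`
     zariski_closure (@Oblique (complex R) m))%classic /\
  (euclidean_closure (@Tight (complex R) m) `<`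
     euclidean_closure (@Oblique (complex R) m))%classic.
Proof.
have obl_O := obl_tensor_oblique (complex R) hm.
(* One witness outside the larger closure of [Tight], the Zariski one, settles both strict
   inclusions. *)
have obl_notT :
    ~ zariski_closure (@Tight (complex R) m) (obl_tensor (complex R) m).
  case: m hm obl_O => // n hn _; apply: rigid_not_zariski_Tight; first by lia.
  exact: obl_tensor_rigid.
split; split.
- exact: zariski_closureS (@Tight_sub_Oblique _ _).
- by move=> /(_ _ (sub_zariski_closure obl_O)).
- exact: euclidean_closureS (@Tight_sub_Oblique _ _).
- by move=> /(_ _ (sub_euclidean_closure obl_O))/euclidean_sub_zariski.
Qed.
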